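(* Let $M_1$ be a safe redex and let $M_2$ be its contractum, i.e. $M_1\,\beta_s\,M_2$. Then (i) $M_2$ is almost safe; and (ii) if $M_1$ is safe then $M_2$ is safe.
   Context: Simple types are generated by $A ::= o \mid A \to A$ ($\to$ associates to the right); $(A_1,\ldots,A_n,B)$ abbreviates $A_1\to\cdots\to A_n\to B$. Orders: $\mathrm{ord}(o)=0$, $\mathrm{ord}(A\to B)=\max(\mathrm{ord}(A)+1,\mathrm{ord}(B))$. Terms are Church-style, built from an infinite set of typed variables and a fixed set $\Xi$ of typed constants. The order of a term or symbol is the order of its type. Safe lambda calculus. Judgements $\Gamma\vdash_{\sf s} M:A$ and $\Gamma\vdash_{\sf asa} M:A$ are defined by mutual induction. ''$c\le \mathrm{ord}\,\Gamma$'' means $c\le \mathrm{ord}(y)$ for every $y\in\Gamma$. (var) $x:A\vdash_{\sf s}x:A$. (const) $\vdash_{\sf s} f:A$ for each constant $f:A$ in $\Xi$. (wk) from $\Gamma\vdash_{\sf s}M:A$ infer $\Delta\vdash_{\sf s}M:A$ if $\Gamma\subset\Delta$. ($\delta$) from $\Gamma\vdash_{\sf s}M:A$ infer $\Gamma\vdash_{\sf asa}M:A$. (app$_{as}$) from $\Gamma\vdash_{\sf asa}M:A\to B$ and $\Gamma\vdash_{\sf s}N:A$ infer $\Gamma\vdash_{\sf asa}MN:B$. (app) from $\Gamma\vdash_{\sf asa}M:A\to B$ and $\Gamma\vdash_{\sf s}N:A$ infer $\Gamma\vdash_{\sf s}MN:B$, provided $\mathrm{ord}(B)\le\mathrm{ord}\,\Gamma$.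 (abs) from $\Gamma,x_1:A_1,\ldots,x_n:A_n\vdash_{\sf asa}M:B$ infer $\Gamma\vdash_{\sf s}\lambda x_1^{A_1}\ldots x_n^{A_n}.M:(A_1,\ldots,A_n,B)$, provided $\mathrm{ord}(A_1,\ldots,A_n,B)\le\mathrm{ord}\,\Gamma$. A term $M$ is safe if $\Gamma\vdash_{\sf s}M:T$ is derivable for some $\Gamma,T$. A term is an almost safe application if it is safe, or it is of the form $N_1\ldots N_m$ ($m\ge1$) where $N_1$ is not an application and every $N_i$ is safe. A term is almost safe if it is an almost safe application, or is of the form $\lambda x_1^{A_1}\ldots x_n^{A_n}.M$ with $n\ge1$ and $M$ an almost safe application. A safe redex is an almost safe application of the form $(\lambda x_1^{A_1}\ldots x_n^{A_n}.M)N_1\ldots N_l$ with $l,n\ge1$ such that $M$ is an almost safe application (consequently each $N_i$ is safe, and $\lambda x_1^{A_1}\ldots x_n^{A_n}.M$ is safe). The relation $\beta_s$ on safe redexes contracts $(\lambda x_1^{A_1}\ldots x_n^{A_n}.M)N_1\ldots N_l \mapsto \lambda x_{l+1}^{A_{l+1}}\ldots x_n^{A_n}.M[N_1\ldots N_l/x_1\ldots x_l]$ if $n>l$, and $(\lambda x_1^{A_1}\ldots x_n^{A_n}.M)N_1\ldots N_l \mapsto M[N_1\ldots N_n/x_1\ldots x_n]\,N_{n+1}\ldots N_l$ if $n\le l$, where $M[R_1\ldots R_k/z_1\ldots z_k]$ is simultaneous (capture-avoiding) substitution; terms are considered up to $\alpha$-conversion. *)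

(* Defs.v *)
From HB Require Import structures.
From Stdlib Require List.
From mathcomp Require Import all_boot.

Set Implicit Arguments.
Unset Strict Implicit.
Unset Printing Implicit Defensive.

(* Terms up to alpha-conversion are represented in locally nameless style:
   free variables are named and typed, bound variables are de Bruijn indices.
   All notions below are nevertheless phrased with names, through the binder
   [abs x M], so that alpha-equivalent terms are syntactically equal.          *)

Inductive ty : Type := o | arr of ty & ty.

Definition ty_eq_dec : comparable ty.
Proof. by move=> A B; rewrite /decidable; decide equality. Defined.

HB.instance Definition _ := hasDecEq.Build ty (compareP ty_eq_dec).

(* (A_1,...,A_n,B) *)
Definition arrs (As : seq ty) (B : ty) : ty := foldr arr B As.

Fixpoint ord (A : ty) : nat :=
  if A is arr A1 A2 then maxn (ord A1).+1 (ord A2) else 0.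

(* A variable carries its type: there are infinitely many of each type. *)
Definition var : Type := (nat * ty)%type.

Definition vty (x : var) : ty := x.2.

(* Contexts are finite sets of typed variables; only membership matters. *)
Definition ctx : Type := seq var.

Definition le_ord (c : nat) (G : ctx) : Prop :=
  forall y : var, y \in G -> c <= ord (vty y).

(* Raw terms may have dangling indices or be ill-typed; the terms of the
   calculus are those satisfying [has_type]. *)
Inductive term (Xi : Type) : Type :=
| BVar of nat
| FVar of var
| Con of Xi
| App of term Xi & term Xi
| Lam of ty & term Xi.

Arguments BVar {Xi}.
Arguments FVar {Xi}.
Arguments Con {Xi}.

Section Terms.
Variable Xi : Type.
Implicit Types (x : var) (xs : seq var) (M N : term Xi) (Ns : seq (term Xi)).

Fixpoint fv M : seq var :=
  match M with
  | FVar x => [:: x]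
  | App M1 M2 => fv M1 ++ fv M2
  | Lam _ M1 => fv M1
  | _ => [::]
  end.

Fixpoint close (k : nat) x M : term Xi :=
  match M with
  | FVar y => if y == x then BVar k else FVar y
  | App M1 M2 => App (close k x M1) (close k x M2)
  | Lam A M1 => Lam A (close k.+1 x M1)
  | _ => M
  end.

(* lambda x^A. M, where A is the type carried by x *)
Definition abs x M : term Xi := Lam (vty x) (close 0 x M).

(* lambda x_1 ... x_n. M *)
Definition abss xs M : term Xi := foldr abs M xs.

(* M N_1 ... N_l *)
Definition apps M Ns : term Xi := foldl (@App Xi) M Ns.

Definition is_app M : bool := if M is App _ _ then true else false.

Fixpoint psubst (s : var -> term Xi) M : term Xi :=
  match M with
  | FVar x => s x
  | App M1 M2 => App (psubst s M1) (psubst s M2)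
  | Lam A M1 => Lam A (psubst s M1)
  | _ => M
  end.

(* M[N_1 ... N_k / x_1 ... x_k], simultaneous; it cannot capture when the N_i
   have no dangling index, which holds for every well-typed N_i. *)
Definition subst xs Ns M : term Xi :=
  psubst (fun x => nth (FVar x) Ns (index x xs)) M.

End Terms.

Section Safe.
Variables (Xi : Type) (cty : Xi -> ty).
Implicit Types (G D : ctx) (x : var) (xs : seq var) (f : Xi).
Implicit Types (M N P : term Xi) (Ns : seq (term Xi)) (A B T : ty).

(* Church-style simple typing *)
Inductive has_type : term Xi -> ty -> Prop :=
| ht_var x : has_type (FVar x) (vty x)
| ht_con f : has_type (Con f) (cty f)
| ht_app M N A B :
    has_type M (arr A B) -> has_type N A -> has_type (App M N) B
| ht_abs x M B :
    has_type M B -> has_type (abs x M) (arr (vty x) B).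

(* [safe_j] is the judgement with subscript s, [asa_j] the one with asa. *)
Inductive safe_j : ctx -> term Xi -> ty -> Prop :=
| s_var x : safe_j [:: x] (FVar x) (vty x)
| s_const f : safe_j [::] (Con f) (cty f)
| s_wk G D M A : safe_j G M A -> {subset G <= D} -> safe_j D M A
| s_app G M N A B :
    asa_j G M (arr A B) -> safe_j G N A -> le_ord (ord B) G ->
    safe_j G (App M N) B
| s_abs G xs M B :
    0 < size xs -> uniq xs -> ~~ has (mem G) xs ->
    asa_j (G ++ xs) M B -> le_ord (ord (arrs (map vty xs) B)) G ->
    safe_j G (abss xs M) (arrs (map vty xs) B)
with asa_j : ctx -> term Xi -> ty -> Prop :=
| asa_delta G M A : safe_j G M A -> asa_j G M A
| asa_app G M N A B :
    asa_j G M (arr A B) -> safe_j G N A -> asa_j G (App M N) B.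

Definition safe M : Prop := exists G T, safe_j G M T.

Definition almost_safe_app M : Prop :=
  safe M \/
  (exists T, has_type M T) /\
  (exists N Ns, [/\ M = apps N Ns, ~~ is_app N, safe N & List.Forall safe Ns]).

Definition almost_safe M : Prop :=
  almost_safe_app M \/
  exists xs P, [/\ 0 < size xs, uniq xs, M = abss xs P & almost_safe_app P].

(* (lambda xs. M) Ns is a safe redex, with this decomposition. It need not be
   unique, since M may itself be an abstraction. *)
Definition safe_redex_form xs M Ns : Prop :=
  [/\ 0 < size xs, 0 < size Ns, uniq xs,
      almost_safe_app (apps (abss xs M) Ns) & almost_safe_app M].

(* In [beta_s_lt], the remaining bound variables are chosen, up to
   alpha-conversion, not free in the arguments. *)
Inductive beta_s : term Xi -> term Xi -> Prop :=
| beta_s_lt xs M Ns :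
    safe_redex_form xs M Ns -> size Ns < size xs ->
    all (fun N => ~~ has (mem (fv N)) (drop (size Ns) xs)) Ns ->
    beta_s (apps (abss xs M) Ns)
           (abss (drop (size Ns) xs) (subst (take (size Ns) xs) Ns M))
| beta_s_ge xs M Ns :
    safe_redex_form xs M Ns -> size xs <= size Ns ->
    beta_s (apps (abss xs M) Ns)
           (apps (subst xs (take (size xs) Ns) M) (drop (size xs) Ns)).

End Safe.

(* Main.v *)
(* The substitution lemma for the safe calculus carries the argument. A safe
   term of type A has only free variables of order at least ord A, so replacing
   a variable of order at least c by a safe term of its type only introduces
   free variables of order at least c: the side conditions on orders survive.
   For a safe redex this makes the substituted body an almost safe application,
   which gives (i). Contraction preserves the type and creates no free variable,
   so the order condition that holds for a safe redex holds for its contractum,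
   and an almost safe application (or an abstraction of one) satisfying that
   condition is safe, which gives (ii). *)
Require Import Defs.
From mathcomp Require Import all_boot.

Set Implicit Arguments.
Unset Strict Implicit.
Unset Printing Implicit Defensive.

Lemma le_ord_sub c (G D : ctx) : {subset D <= G} -> le_ord c G -> le_ord c D.
Proof. by move=> sDG cG y /sDG; exact: cG. Qed.

(** * Application spines, free variables, and substitution under binders *)

Section Syntax.
Variable Xi : Type.
Implicit Types (x : var) (xs : seq var) (M N : term Xi) (Ns : seq (term Xi)).

Lemma apps_rcons M Ns N : apps M (rcons Ns N) = App (apps M Ns) N.
Proof. exact: foldl_rcons. Qed.

Lemma apps_cat M Ns Ns' : apps M (Ns ++ Ns') = apps (apps M Ns) Ns'.
Proof. exact: foldl_cat. Qed.

Lemma apps_inj M M' Ns Ns' : ~~ is_app M -> ~~ is_app M' ->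
  apps M Ns = apps M' Ns' -> M = M' /\ Ns = Ns'.
Proof.
move=> nM nM'; elim/last_ind: Ns Ns' => [|Ns N IH] Ns'; case/lastP: Ns' => [|Ns' N'];
  rewrite ?apps_rcons //=.
- by move=> eM; rewrite eM in nM.
- by move=> eM; rewrite -eM in nM'.
- by case=> /IH[-> ->] ->.
Qed.

Lemma fv_apps M Ns : fv (apps M Ns) = fv M ++ flatten (map (@fv Xi) Ns).
Proof.
elim: Ns M => [|N Ns IH] M /=; first by rewrite cats0.
by rewrite IH /= catA.
Qed.

Lemma fv_close k x M : fv (close k x M) = [seq y <- fv M | y != x].
Proof.
elim: M k => //= [y|M IHM N IHN] k.
- by case: eqP.
- by rewrite filter_cat IHM IHN.
Qed.

Lemma mem_fv_abss y xs M : (y \in fv (abss xs M)) = (y \notin xs) && (y \in fv M).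
Proof.
elim: xs => //= x xs IH.
by rewrite fv_close mem_filter IH inE negb_or andbA.
Qed.

Lemma fv_psubst (s : var -> term Xi) M :
  fv (psubst s M) = flatten [seq fv (s y) | y <- fv M].
Proof.
elim: M => //= [y|M IHM N IHN]; first by rewrite cats0.
by rewrite map_cat flatten_cat IHM IHN.
Qed.

Lemma close_fresh k x M : x \notin fv M -> close k x M = M.
Proof.
elim: M k => //= [y|M IHM N IHN|A M IH] k.
- by rewrite inE eq_sym => /negbTE ->.
- by rewrite mem_cat negb_or => /andP[/IHM-> /IHN->].
- by move/IH->.
Qed.

(** Passage under one binder: [s'] acts as [s] but renames the bound [x] to [x']. Freshness of [x']
    keeps the new [close] from capturing variables of the images. *)
Lemma psubst_close (s s' : var -> term Xi) k x x' M :
    s' x = FVar x' -> {in fv M, forall y, y != x -> s' y = s y} ->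
    {in fv M, forall y, y != x -> x' \notin fv (s y)} ->
  psubst s (close k x M) = close k x' (psubst s' M).
Proof.
move=> s'x; elim: M k => //= [y|M IHM N IHN|A M IH] k ss' fr.
- have [->|neq] := eqVneq y x; first by rewrite s'x /= eqxx.
  by rewrite /= ss' ?inE // close_fresh // fr ?inE.
- by congr App; [apply: IHM|apply: IHN] => y yM; (apply: ss' || apply: fr);
    rewrite mem_cat yM ?orbT.
- by congr Lam; apply: IH.
Qed.

(* Bound variables are renamed by the substitution itself, so the substitution
   lemma needs no separate invariance of derivability under renaming. *)
Definition override (s : var -> term Xi) xs xs' : var -> term Xi :=
  fun y => if y \in xs then FVar (nth y xs' (index y xs)) else s y.

Lemma psubst_abss (s : var -> term Xi) xs xs' M :
    map vty xs' = map vty xs -> uniq xs -> uniq xs' ->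
    {in fv (abss xs M), forall y, ~~ has (mem (fv (s y))) xs'} ->
  psubst s (abss xs M) = abss xs' (psubst (override s xs xs') M).
Proof.
elim: xs xs' s => [|x xs IH] [|x' xs'] s //= [vx vxs] /andP[xxs Uxs] /andP[xxs' Uxs'] fr.
rewrite /abs vx /=; congr Lam.
pose s1 y := if y == x then FVar x' else s y.
have fr1 : {in fv (abss xs M), forall y, y != x -> ~~ has (mem (fv (s y))) (x' :: xs')}.
  by move=> y yM neq; apply: fr; rewrite fv_close mem_filter neq.
rewrite (@psubst_close s s1 0 x x').
- congr close; rewrite (IH xs' s1) //; last first.
    move=> y yM; rewrite /s1; case: eqVneq => [_|neq].
      by apply/hasPn => z zxs' /=; rewrite mem_seq1; apply: contraNneq xxs' => <-.
    by have := fr1 y yM neq; rewrite /= negb_or => /andP[].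
  congr abss; elim: M {IH fr fr1} => //= [y|M -> N ->|A M ->] //.
  rewrite /override /s1 inE; have [->|neq] := eqVneq y x.
    by rewrite (negbTE xxs) /= eqxx.
  by rewrite /= eq_sym (negbTE neq).
- by rewrite /s1 eqxx.
- by move=> y _ /negbTE neq; rewrite /s1 neq.
- by move=> y yM neq; have := fr1 y yM neq; rewrite /= negb_or => /andP[].
Qed.

Lemma fresh_vars (As : seq ty) (L : seq var) : exists xs : seq var,
  [/\ map vty xs = As, uniq xs & ~~ has (mem L) xs].
Proof.
elim: As => [|A As [xs [vxs Uxs fr]]]; first by exists [::].
(* [n] exceeds every first component in use, so [(n, A)] is new whatever [A] is. *)
pose n := \max_(y <- L ++ xs) y.1.+1.
have fr_n : (n, A) \notin L ++ xs.
  apply/negP => inL; have: n < n by apply: (@leq_bigmax_seq _ _ xpredT (fun y : var => y.1.+1) (n, A)).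
  by rewrite ltnn.
move: fr_n; rewrite mem_cat negb_or => /andP[nL nxs].
by exists ((n, A) :: xs); rewrite /= vxs nxs Uxs (negbTE nL).
Qed.

End Syntax.

(** * Uniqueness of types, and types along an application spine *)

Section Typing.
Variables (Xi : Type) (cty : Xi -> ty).
Implicit Types (E : seq ty) (x : var) (xs : seq var).
Implicit Types (M N : term Xi) (Ns : seq (term Xi)) (A B T : ty).

Definition app_ty (a b : option ty) : option ty :=
  if a is Some (arr A B) then if b == Some A then Some B else None else None.

(* [E] lists the types of the dangling indices, innermost binder first. *)
Fixpoint infer E M : option ty :=
  match M with
  | BVar i => onth E i
  | FVar x => Some (vty x)
  | Con f => Some (cty f)
  | App M N => app_ty (infer E M) (infer E N)
  | Lam A M => omap (arr A) (infer (A :: E) M)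
  end.

Lemma app_tyP a b B : app_ty a b = Some B ->
  exists2 A, a = Some (arr A B) & b = Some A.
Proof.
case: a => [[|A B']|] //=; case: eqP => // -> [<-]; by exists A.
Qed.

(** The closed variable refers past the [size E] binders already crossed, so its type joins [E] at
    the outer end. *)
Lemma infer_close E x M A : infer E M = Some A ->
  infer (rcons E (vty x)) (close (size E) x M) = Some A.
Proof.
elim: M E A => //= [i|y|M IHM N IHN|C M IH] E A.
- by rewrite -cats1 onth_cat; case: ltnP => // /onth_default->.
- by case: eqP => [->|//] /= <-; rewrite -cats1 onth_cat ltnn subnn.
- by case/app_tyP => B /IHM-> /IHN->; rewrite /= eqxx.
- case EM: (infer _ M) => [B|//] [<-].
  by have := IH _ _ EM; rewrite rcons_cons /= => ->.
Qed.

(** Inverting [ht_abs] does not recover the name and body hidden in [abs x M]. A function of the raw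
    term avoids this and yields uniqueness of types. *)
Lemma has_type_infer M A : has_type cty M A -> infer [::] M = Some A.
Proof.
elim=> //= {M A} [M N A B _ -> _ ->|x M B _ IH]; first by rewrite /= eqxx.
by have /= -> := @infer_close [::] x _ _ IH.
Qed.

Lemma has_type_uniq M A B : has_type cty M A -> has_type cty M B -> A = B.
Proof. by move=> /has_type_infer MA /has_type_infer; rewrite MA => -[]. Qed.

Lemma has_type_abss xs M B :
  has_type cty M B -> has_type cty (abss xs M) (arrs (map vty xs) B).
Proof. by move=> MB; elim: xs => //= x xs IH; apply: ht_abs. Qed.

Lemma eq_infer_apps M M' Ns : infer [::] M = infer [::] M' ->
  infer [::] (apps M Ns) = infer [::] (apps M' Ns).
Proof. by elim: Ns M M' => //= N Ns IH M M' eM; apply: IH => /=; rewrite eM. Qed.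

Lemma infer_apps M Ns T : infer [::] (apps M Ns) = Some T ->
  exists2 As, infer [::] M = Some (arrs As T) & map (infer [::]) Ns = map Some As.
Proof.
elim: Ns M => [|N Ns IH] M /=; first by exists [::].
move=> /IH[As /app_tyP[A MA NA] NsAs].
by exists (A :: As) => //; congr cons.
Qed.

(** The targets may themselves be arrow types, so it is the length comparison that decides which
    list is a prefix of the other. *)
Lemma arrs_size_le As Bs A B : arrs As A = arrs Bs B -> size As <= size Bs ->
  As = take (size As) Bs /\ A = arrs (drop (size As) Bs) B.
Proof.
elim: As Bs => [|A1 As IH] [|B1 Bs] //= [<- eAB] le.
by have [e1 e2] := IH _ eAB le; split; first congr cons.
Qed.

Lemma infer_apps_arrs M Ns As B T :
    infer [::] M = Some (arrs As B) -> size Ns <= size As ->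
    infer [::] (apps M Ns) = Some T ->
  map (infer [::]) Ns = map Some (take (size Ns) As) /\ T = arrs (drop (size Ns) As) B.
Proof.
move=> MA le /infer_apps[Cs]; rewrite MA => -[eA] eNs.
have sz : size Ns = size Cs by rewrite -(size_map (infer [::])) eNs size_map.
by rewrite eNs sz; case: (arrs_size_le (esym eA)) => [|<- ->]; rewrite -?sz.
Qed.

End Typing.

Scheme safe_j_mut_ind := Induction for safe_j Sort Prop
  with asa_j_mut_ind := Induction for asa_j Sort Prop.
Combined Scheme safe_asa_ind from safe_j_mut_ind, asa_j_mut_ind.

(** * Structural properties of the two judgements *)

Section SafeCalculus.
Variables (Xi : Type) (cty : Xi -> ty).
Implicit Types (G D : ctx) (x : var) (xs : seq var).
Implicit Types (M N P : term Xi) (Ns : seq (term Xi)) (A B T : ty).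

Local Notation sj := (safe_j cty).
Local Notation aj := (asa_j cty).
Local Notation infer := (infer cty [::]).

(** The weakening rule exists only for [safe_j]; here it is pushed along the spine to the safe head
    and the safe arguments. *)
Lemma asa_wk G D M A : aj G M A -> {subset G <= D} -> aj D M A.
Proof.
move=> GM; elim: GM D => {G M A} [G M A GM|G M N A B _ IH GN] D sGD.
  by apply: asa_delta; apply: s_wk GM sGD.
by apply: asa_app (IH _ sGD) _; apply: s_wk GN sGD.
Qed.

Lemma safe_asa_has_type :
  (forall G M A, sj G M A -> has_type cty M A) /\
  (forall G M A, aj G M A -> has_type cty M A).
Proof.
apply: safe_asa_ind => // [x|f|G M N A B _ HM _ HN _|G xs M B _ _ _ _ HM _|G M N A B _ HM _ HN].
- exact: ht_var.
- exact: ht_con.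
- exact: ht_app HM HN.
- exact: has_type_abss.
- exact: ht_app HM HN.
Qed.

Lemma safe_has_type G M A : sj G M A -> has_type cty M A.
Proof. exact: safe_asa_has_type.1. Qed.

Lemma asa_has_type G M A : aj G M A -> has_type cty M A.
Proof. exact: safe_asa_has_type.2. Qed.

Lemma safe_asa_fv :
  (forall G M A, sj G M A -> {subset fv M <= G}) /\
  (forall G M A, aj G M A -> {subset fv M <= G}).
Proof.
apply: safe_asa_ind => //= [x y //|G D M A _ IH sGD y /IH/sGD //|||].
- by move=> G M N A B _ IHM _ IHN _ y; rewrite mem_cat => /orP[/IHM|/IHN].
- move=> G xs M B _ _ _ _ IH _ y; rewrite mem_fv_abss => /andP[yxs /IH].
  by rewrite mem_cat (negbTE yxs) orbF.
- by move=> G M N A B _ IHM _ IHN y; rewrite mem_cat => /orP[/IHM|/IHN].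
Qed.

(** Order conditions bound every variable of the context from below, so they persist in a smaller
    one. *)
Lemma safe_asa_strengthen :
  (forall G M A, sj G M A -> sj (fv M) M A) /\
  (forall G M A, aj G M A -> aj (fv M) M A).
Proof.
apply: safe_asa_ind => //= [x|f|G M N A B GM HM GN HN cG|
  G xs M B sz Uxs fr GM HM cG|G M A _|G M N A B _ HM _ HN].
- exact: s_var.
- exact: s_const.
- have sG : {subset fv (App M N) <= G} by apply: safe_asa_fv.1; apply: s_app GM GN cG.
  apply: s_app (le_ord_sub sG cG).
    by apply: asa_wk HM _ => y yM; rewrite /= mem_cat yM.
  by apply: s_wk HN _ => y yN; rewrite /= mem_cat yN orbT.
- have sG : {subset fv (abss xs M) <= G} by apply: safe_asa_fv.1; apply: s_abs sz Uxs fr GM cG.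
  apply: s_abs sz Uxs _ _ (le_ord_sub sG cG).
    by apply/hasPn => y yxs /=; rewrite mem_fv_abss yxs.
  by apply: asa_wk HM _ => y yM; rewrite mem_cat mem_fv_abss yM andbT orNb.
- exact: asa_delta.
- apply: asa_app; first by apply: asa_wk HM _ => y yM; rewrite mem_cat yM.
  by apply: s_wk HN _ => y yN; rewrite mem_cat yN orbT.
Qed.

Lemma safe_strengthen G M A : sj G M A -> sj (fv M) M A.
Proof. exact: safe_asa_strengthen.1. Qed.

Lemma asa_strengthen G M A : aj G M A -> aj (fv M) M A.
Proof. exact: safe_asa_strengthen.2. Qed.

(** Application and abstraction impose the bound as a side condition. Weakening may add variables of
    low order to the context, but none to the term; hence [fv M] and not [G]. *)
Lemma safe_le_ord G M A : sj G M A -> le_ord (ord A) (fv M).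
Proof.
elim=> //= {G M A} [x y|G M N A B GM GN _ cG|G xs M B _ _ _ GM cG].
- by rewrite inE => /eqP->.
- by apply: le_ord_sub cG; apply: (safe_asa_fv.2 _ _ _ (asa_app GM GN)).
- apply: le_ord_sub cG => y; rewrite mem_fv_abss => /andP[yxs /(safe_asa_fv.2 _ _ _ GM)].
  by rewrite mem_cat (negbTE yxs) orbF.
Qed.

(** The order condition is all that separates [s_app] from [asa_app], and strengthening allows it to
    be checked on free variables alone. *)
Lemma asa_le_ord_safe G M A : aj G M A -> le_ord (ord A) (fv M) -> sj (fv M) M A.
Proof.
move=> GM cM; case: GM cM (asa_strengthen GM) => {G M A} [G M A GM _ _|G M N A B GM GN cM _].
  exact: safe_strengthen GM.
apply: s_app cM.
  by apply: asa_wk (asa_strengthen GM) _ => y yM; rewrite /= mem_cat yM.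
by apply: s_wk (safe_strengthen GN) _ => y yN; rewrite /= mem_cat yN orbT.
Qed.

Lemma asa_abss_safe G xs M B : 0 < size xs -> uniq xs -> aj G M B ->
    le_ord (ord (arrs (map vty xs) B)) (fv (abss xs M)) ->
  safe cty (abss xs M).
Proof.
move=> sz Uxs GM cM; exists (fv (abss xs M)), (arrs (map vty xs) B).
apply: s_abs sz Uxs _ _ cM.
  by apply/hasPn => y yxs /=; rewrite mem_fv_abss yxs.
by apply: asa_wk (asa_strengthen GM) _ => y yM; rewrite mem_cat mem_fv_abss yM andbT orNb.
Qed.

(** Every application rule adds one safe argument, so unwinding a spine ends at a variable, a
    constant or an abstraction, introduced by a rule for [safe_j]. *)
Lemma safe_asa_apps :
  (forall G M A, sj G M A -> exists N Ns,
    [/\ M = apps N Ns, ~~ is_app N, safe cty N & List.Forall (safe cty) Ns]) /\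
  (forall G M A, aj G M A -> exists N Ns,
    [/\ M = apps N Ns, ~~ is_app N, safe cty N & List.Forall (safe cty) Ns]).
Proof.
have appE G M N A : sj G N A -> (exists P Ns,
    [/\ M = apps P Ns, ~~ is_app P, safe cty P & List.Forall (safe cty) Ns]) ->
  exists P Ns,
    [/\ App M N = apps P Ns, ~~ is_app P, safe cty P & List.Forall (safe cty) Ns].
  move=> GN [P [Ns [-> nP sP sNs]]]; exists P, (rcons Ns N); split=> //.
    by rewrite apps_rcons.
  rewrite -cats1; apply/List.Forall_app; split=> //.
  by apply: List.Forall_cons => //; exists G, A.
apply: safe_asa_ind => //.
- move=> x; exists (FVar x), [::]; split=> //; by exists [:: x], (vty x); apply: s_var.
- move=> f; exists (Con f), [::]; split=> //; by exists [::], (cty f); apply: s_const.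
- move=> G M N A B _ HM GN _ _; exact: appE GN HM.
- move=> G xs M B sz Uxs fr GM _ cG; exists (abss xs M), [::]; split=> //.
    by case: xs sz {Uxs fr GM cG}.
  by exists G, (arrs (map vty xs) B); apply: s_abs.
- move=> G M N A B _ HM GN _; exact: appE GN HM.
Qed.

Lemma asa_almost_safe_app G M A : aj G M A -> almost_safe_app cty M.
Proof.
move=> GM; right; split; first by exists A; apply: asa_has_type GM.
exact: safe_asa_apps.2 GM.
Qed.

Lemma asa_apps G M Ns A T : aj G M A -> List.Forall (safe cty) Ns ->
  infer (apps M Ns) = Some T -> exists D, aj D (apps M Ns) T.
Proof.
move=> GM sNs; elim: sNs G M A GM => {Ns} [|N Ns [D [B DN]] sNs IH] G M A GM /=.
  by rewrite (has_type_infer (asa_has_type GM)) => -[<-]; exists G.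
move=> eT; have [As /= /app_tyP[C]] := infer_apps eT.
rewrite (has_type_infer (asa_has_type GM)) (has_type_infer (safe_has_type DN)).
move=> [eA] [eB] _; apply: IH eT.
(* [asa_app] has no order condition, so the contexts of head and argument can simply be merged. *)
apply: (@asa_app _ _ (G ++ D) _ _ C (arrs As T)).
  by rewrite -eA; apply: asa_wk GM _ => y yG; rewrite mem_cat yG.
by rewrite -eB; apply: s_wk DN _ => y yD; rewrite mem_cat yD orbT.
Qed.

(** With [asa_almost_safe_app], this identifies almost safe applications with the terms derivable in
    [asa_j]. *)
Lemma almost_safe_app_asa M : almost_safe_app cty M -> exists G T, aj G M T.
Proof.
case=> [[G [T GM]]|[[T MT] [N [Ns [eM _ [G [A GN]] sNs]]]]].
  by exists G, T; apply: asa_delta.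
have MT' := has_type_infer MT; rewrite eM in MT' *.
by have [D DM] := asa_apps (asa_delta GN) sNs MT'; exists D, T.
Qed.

Lemma almost_safe_app_args M Ns : ~~ is_app M -> almost_safe_app cty (apps M Ns) ->
  List.Forall (safe cty) Ns.
Proof.
move=> nM /almost_safe_app_asa[G [T /(safe_asa_apps.2 _ _ _)]].
by case=> [N [Ns' [eM nN _ sNs']]]; have [_ ->] := apps_inj nM nN eM.
Qed.

(** * The substitution lemma *)

Definition safe_at (s : var -> term Xi) x := sj (fv (s x)) (s x) (vty x).

Definition subst_ctx (s : var -> term Xi) G : ctx := flatten [seq fv (s x) | x <- G].

Lemma subst_ctx_sub s G D : {subset G <= D} -> {subset subst_ctx s G <= subst_ctx s D}.
Proof.
move=> sGD y /flattenP[t /mapP[x xG ->] yt].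
by apply/flattenP; exists (fv (s x)) => //; apply: map_f; apply: sGD.
Qed.

(** Transitivity through [ord (vty x)]: it is at least [c], and by [safe_le_ord] at most the order
    of each free variable of [s x]. *)
Lemma le_ord_subst_ctx s G c : {in G, forall x, safe_at s x} ->
  le_ord c G -> le_ord c (subst_ctx s G).
Proof.
move=> sG cG y /flattenP[t /mapP[x xG ->] yt].
exact: leq_trans (cG x xG) (safe_le_ord (sG x xG) yt).
Qed.

Lemma safe_asa_subst :
  (forall G M A, sj G M A -> forall s, {in G, forall x, safe_at s x} ->
    sj (subst_ctx s G) (psubst s M) A) /\
  (forall G M A, aj G M A -> forall s, {in G, forall x, safe_at s x} ->
    aj (subst_ctx s G) (psubst s M) A).
Proof.
apply: safe_asa_ind => /=.
- by move=> x s sx; rewrite /subst_ctx /= cats0; apply: sx; rewrite inE.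
- by move=> f s _; apply: s_const.
- move=> G D M A _ IH sGD s sD; apply: s_wk (IH s _) (subst_ctx_sub sGD).
  by move=> x /sGD; apply: sD.
- move=> G M N A B _ IHM _ IHN cG s sG.
  by apply: s_app (IHM s sG) (IHN s sG) _; apply: le_ord_subst_ctx.
- move=> G xs M B sz Uxs fr GM IH cG s sG.
  (* The new names avoid all of [subst_ctx s G], since [s_abs] asks for binders disjoint from the
     whole context. *)
  have [xs' [vxs Uxs' fr']] := fresh_vars (map vty xs) (subst_ctx s G).
  have szE : size xs' = size xs by rewrite -(size_map vty) vxs size_map.
  rewrite (psubst_abss vxs Uxs Uxs'); last first.
    move=> y; rewrite mem_fv_abss => /andP[yxs /(safe_asa_fv.2 _ _ _ GM)].
    rewrite mem_cat (negbTE yxs) orbF => yG; apply: contra fr' => /hasP[z zxs' zy].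
    by apply/hasP; exists z => //; apply/flattenP; exists (fv (s y)) => //; apply: map_f.
  rewrite -vxs; apply: s_abs => //; first by rewrite szE.
  (* The induction hypothesis is used with the renaming of [xs] to [xs'] built in; the context it
     yields lies in [subst_ctx s G ++ xs']. *)
  + apply: asa_wk (IH (override s xs xs') _) _.
    * move=> x; rewrite mem_cat /safe_at /override; case: ifP => [xxs _|_].
        have lt : index x xs < size xs by rewrite index_mem.
        have -> : vty x = vty (nth x xs' (index x xs)).
          by rewrite -(nth_map x o) ?szE // vxs (nth_map x) // nth_index.
        exact: s_var.
      by rewrite orbF; apply: sG.
    * move=> y /flattenP[t /mapP[x]]; rewrite mem_cat /override; case: ifP => [xxs _ ->|_].
        by rewrite inE => /eqP->; rewrite mem_cat mem_nth ?orbT // szE index_mem.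
      rewrite orbF => xG -> yx; rewrite mem_cat; apply/orP; left.
      by apply/flattenP; exists (fv (s x)) => //; apply: map_f.
  + by rewrite vxs; apply: le_ord_subst_ctx.
- by move=> G M A _ IH s sG; apply: asa_delta; apply: IH.
- move=> G M N A B _ IHM _ IHN s sG; exact: asa_app (IHM s sG) (IHN s sG).
Qed.

Lemma asa_subst G M A xs Ns : aj G M A -> List.Forall (safe cty) Ns ->
    map infer Ns = map Some (map vty xs) ->
  exists D, aj D (subst xs Ns M) A.
Proof.
move=> GM sNs eNs.
have sz : size Ns = size xs by rewrite -(size_map infer) eNs !size_map.
eexists; apply: safe_asa_subst.2 GM _ _ => x _; rewrite /safe_at.
have [xxs|xxs] := boolP (x \in xs); last first.
  (* Off [xs] the index is [size xs], which is also [size Ns], so [nth] returns its default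
     [FVar x]. *)
  by rewrite nth_default ?sz ?(memNindex xxs) //; apply: s_var.
have lt : index x xs < size xs by rewrite index_mem.
have [G' [A' GN]] : safe cty (nth (FVar x) Ns (index x xs)).
  elim: sNs (index x xs) {eNs lt sz} => [|N Ns' sN _ IH] [|i] //=;
    by exists [:: x], (vty x); apply: s_var.
have := congr1 (nth None ^~ (index x xs)) eNs.
rewrite (nth_map (FVar x)) ?sz // (has_type_infer (safe_has_type GN)).
rewrite (nth_map o) ?size_map // (nth_map x) // nth_index // => -[<-].
exact: safe_strengthen GN.
Qed.

Lemma mem_fv_subst xs Ns M y : size Ns = size xs -> y \in fv (subst xs Ns M) ->
  (y \in fv M) && (y \notin xs) || (y \in flatten (map (@fv Xi) Ns)).
Proof.
move=> sz; rewrite fv_psubst => /flattenP[t /mapP[x xM ->]].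
have [xxs|xxs] := boolP (x \in xs); last first.
  by rewrite nth_default ?sz ?(memNindex xxs) // inE => /eqP->; rewrite xM xxs.
move=> yN; apply/orP; right; apply/flattenP.
exists (fv (nth (FVar x) Ns (index x xs))) => //.
have lt : index x xs < size Ns by rewrite sz index_mem.
by rewrite -(nth_map _ [::]) // mem_nth // size_map.
Qed.

(** * Safe redexes and their contraction *)

Lemma safe_has_type_le_ord M T : has_type cty M T -> safe cty M ->
  le_ord (ord T) (fv M).
Proof.
move=> MT [G [A GM]]; rewrite (has_type_uniq MT (safe_has_type GM)).
exact: safe_le_ord GM.
Qed.

Lemma safe_redex_formP xs M Ns : safe_redex_form cty xs M Ns ->
  [/\ List.Forall (safe cty) Ns, exists T, has_type cty (apps (abss xs M) Ns) T &
      exists G B, aj G M B].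
Proof.
case=> xs0 _ _ redex /almost_safe_app_asa asaM; split=> //.
  by apply: almost_safe_app_args redex; case: xs xs0.
by have [G [T /asa_has_type MT]] := almost_safe_app_asa redex; exists T.
Qed.

End SafeCalculus.

Theorem lemma1p16 (Xi : Type) (cty : Xi -> ty) (M1 M2 : term Xi) :
  beta_s cty M1 M2 ->
  almost_safe cty M2 /\ (safe cty M1 -> safe cty M2).
Proof.
case=> xs M Ns redex lt => [_|]; have [xs0 _ Uxs _ _] := redex;
  have [sNs [T M1T] [G [B GM]]] := safe_redex_formP redex;
  have lamT := has_type_infer (has_type_abss xs (asa_has_type GM));
  have eT := has_type_infer M1T.
(* Fewer arguments than binders: [eNs] matches the arguments with the first binders, and [eB] says
   that the contractum has the type [T] of the redex. *)
- have [|eNs eB] := infer_apps_arrs lamT _ eT; first by rewrite size_map ltnW.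
  rewrite -map_take in eNs; rewrite -map_drop in eB.
  have sz : size Ns = size (take (size Ns) xs) by rewrite size_takel // ltnW.
  have [D DP] := asa_subst GM sNs eNs.
  split=> [|/(safe_has_type_le_ord M1T) cM1].
    right; exists (drop (size Ns) xs), (subst (take (size Ns) xs) Ns M).
    split=> //; [by rewrite size_drop subn_gt0|exact: drop_uniq|].
    exact: asa_almost_safe_app DP.
  apply: asa_abss_safe DP _; [by rewrite size_drop subn_gt0|exact: drop_uniq|].
  rewrite -eB; apply: le_ord_sub cM1 => y.
  rewrite mem_fv_abss fv_apps mem_cat mem_fv_abss => /andP[ydrop /(mem_fv_subst sz)].
  case/orP=> [/andP[-> ytake]|->]; last by rewrite orbT.
  (* A variable of [M] outside both the consumed and the remaining binders is free in the original
     abstraction. *)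
  by rewrite -(cat_take_drop (size Ns) xs) mem_cat negb_or ytake ydrop.
- set n := size xs.
  have szN : size (take n Ns) = n by rewrite size_takel.
  (* The first [n] arguments saturate the abstraction; [As] are the types of the surplus ones, so
     the body type [B] is [arrs As T]. *)
  have [As eF _] : exists2 As,
      infer cty [::] (apps (abss xs M) (take n Ns)) = Some (arrs As T) &
      map (infer cty [::]) (drop n Ns) = map Some As.
    by apply: infer_apps; rewrite -apps_cat cat_take_drop.
  have [|eNs eB] := infer_apps_arrs lamT _ eF; first by rewrite size_map szN.
  rewrite szN -map_take take_size in eNs; rewrite szN -map_drop drop_size /= in eB.
  move: sNs; rewrite -{1}(cat_take_drop n Ns) => /List.Forall_app[sN1 sN2].
  have [D DP] := asa_subst GM sN1 eNs.
  have [D' DM2] : exists D', asa_j cty D' (apps (subst xs (take n Ns) M) (drop n Ns)) T.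
    (* The substituted body has the type of the saturated abstraction, so exchanging these heads
       preserves the type of the whole spine. *)
    apply: (asa_apps DP sN2); rewrite -eT -{3}(cat_take_drop n Ns) apps_cat.
    by apply: eq_infer_apps; rewrite eF eB (has_type_infer (asa_has_type DP)).
  split=> [|/(safe_has_type_le_ord M1T) cM1].
    by left; apply: asa_almost_safe_app DM2.
  exists (fv (apps (subst xs (take n Ns) M) (drop n Ns))), T.
  apply: asa_le_ord_safe DM2 (le_ord_sub _ cM1) => y.
  rewrite -{3}(cat_take_drop n Ns) !fv_apps map_cat flatten_cat !mem_cat mem_fv_abss.
  case/orP=> [/(mem_fv_subst szN)/orP[/andP[-> ->]|->]|->] //; by rewrite !orbT.
Qed.
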